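(* Let $S$ be a surface of revolution in $E^{3}$ with nowhere vanishing Gaussian curvature $K$, and suppose its position vector $\boldsymbol{x}$ satisfies $\Delta^{II}\boldsymbol{x}=A\boldsymbol{x}$ for some real $3\times 3$ matrix $A$. Then $S$ is (an open part of) a catenoid or (an open part of) a sphere.
   Context: A surface of revolution is given (after a rigid motion placing the axis of revolution on the $z$-axis) by $\boldsymbol{x}(u,v)=(p(u)\cos v,\,p(u)\sin v,\,q(u))$, $u\in(a,b)$, $v\in[0,2\pi)$, where $p,q$ are smooth, $p>0$, and the profile curve $u\mapsto(p(u),0,q(u))$ is parametrized by arc length, $(p')^{2}+(q')^{2}=1$. Let $\boldsymbol{n}=\frac{\boldsymbol{x}_{u^1}\times\boldsymbol{x}_{u^2}}{\|\boldsymbol{x}_{u^1}\times\boldsymbol{x}_{u^2}\|}$ be the unit normal and $II=b_{ij}du^{i}du^{j}$ the second fundamental form with $b_{ij}=\langle \boldsymbol{x}_{u^iu^j},\boldsymbol{n}\rangle$ (with $(u^1,u^2)=(u,v)$). Since $K\neq0$, $(b_{ij})$ is nondegenerate; let $(b^{ij})$ be its inverse and $b=\det(b_{ij})$. The Laplace (second Beltrami) operator of $II$ acting on a smooth function $f$ is $$\Delta^{II}f=-\frac{1}{\sqrt{|b|}}\frac{\partial}{\partial u^{i}}\Big(\sqrt{|b|}\,b^{ij}\frac{\partial f}{\partial u^{j}}\Big)$$ (summation over $i,j$), and $\Delta^{II}\boldsymbol{x}=(\Delta^{II}x_1,\Delta^{II}x_2,\Delta^{II}x_3)$ is applied to the coordinate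 functions of $\boldsymbol{x}$; $A\boldsymbol{x}$ is the matrix acting on the column vector $(x_1,x_2,x_3)^T$. *)

(* Defs.v *)
From Stdlib Require Import Reals Lra.
From Coquelicot Require Import Coquelicot.
Open Scope R_scope.

(* Vectors in E^3 are functions nat -> R (components 0,1,2);
   a parametrized surface is X : nat -> R -> R -> R, X k u v = k-th coordinate
   of x(u,v).  Parameter indices: 0 for u = u^1, 1 for v = u^2. *)

Definition smooth_on (f : R -> R) (a b : R) : Prop :=
  forall (n : nat) (u : R), a < u < b -> ex_derive (Derive_n f n) u.

Definition pd (i : nat) (f : R -> R -> R) (u v : R) : R :=
  match i with
  | O => Derive (fun t => f t v) u
  | _ => Derive (fun t => f u t) v
  end.

Definition dot3 (a b : nat -> R) : R := a 0%nat * b 0%nat + a 1%nat * b 1%nat + a 2%nat * b 2%nat.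

Definition cross3 (a b : nat -> R) (k : nat) : R :=
  match k with
  | O => a 1%nat * b 2%nat - a 2%nat * b 1%nat
  | 1%nat => a 2%nat * b 0%nat - a 0%nat * b 2%nat
  | _ => a 0%nat * b 1%nat - a 1%nat * b 0%nat
  end.

Definition norm3 (a : nat -> R) : R := sqrt (dot3 a a).

Definition xd (X : nat -> R -> R -> R) (i : nat) (u v : R) : nat -> R :=
  fun k => pd i (X k) u v.
Definition xdd (X : nat -> R -> R -> R) (i j : nat) (u v : R) : nat -> R :=
  fun k => pd i (pd j (X k)) u v.

Definition unit_normal (X : nat -> R -> R -> R) (u v : R) : nat -> R :=
  fun k => cross3 (xd X 0 u v) (xd X 1 u v) k / norm3 (cross3 (xd X 0 u v) (xd X 1 u v)).

Definition fff (X : nat -> R -> R -> R) (u v : R) (i j : nat) : R :=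
  dot3 (xd X i u v) (xd X j u v).
Definition sff (X : nat -> R -> R -> R) (u v : R) (i j : nat) : R :=
  dot3 (xdd X i j u v) (unit_normal X u v).

Definition det2 (M : nat -> nat -> R) : R := M 0%nat 0%nat * M 1%nat 1%nat - M 0%nat 1%nat * M 1%nat 0%nat.
Definition inv2 (M : nat -> nat -> R) (i j : nat) : R :=
  (match i, j with
   | O, O => M 1%nat 1%nat
   | S _, S _ => M 0%nat 0%nat
   | _, _ => - M i j
   end) / det2 M.

Definition gauss_curv (X : nat -> R -> R -> R) (u v : R) : R :=
  det2 (sff X u v) / det2 (fff X u v).

Definition bdet (X : nat -> R -> R -> R) (u v : R) : R := det2 (sff X u v).
Definition binv (X : nat -> R -> R -> R) (u v : R) (i j : nat) : R := inv2 (sff X u v) i j.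

Definition sum2 (f : nat -> R) : R := f 0%nat + f 1%nat.

Definition LapII (X : nat -> R -> R -> R) (f : R -> R -> R) (u v : R) : R :=
  - / sqrt (Rabs (bdet X u v)) *
  sum2 (fun i =>
    pd i (fun u' v' => sqrt (Rabs (bdet X u' v')) *
                        sum2 (fun j => binv X u' v' i j * pd j f u' v')) u v).

Definition surf_rev (p q : R -> R) (k : nat) (u v : R) : R :=
  match k with
  | O => p u * cos v
  | 1%nat => p u * sin v
  | _ => q u
  end.

Definition matvec3 (A : nat -> nat -> R) (x : nat -> R) (k : nat) : R :=
  A k 0%nat * x 0%nat + A k 1%nat * x 1%nat + A k 2%nat * x 2%nat.

Definition in_dom (a b u v : R) : Prop := a < u < b /\ 0 <= v < 2 * PI.

Definition on_catenoid (c d : R) (P : nat -> R) : Prop :=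
  sqrt (P 0%nat ^ 2 + P 1%nat ^ 2) = c * cosh ((P 2%nat - d) / c).

Definition on_sphere (C : nat -> R) (r : R) (P : nat -> R) : Prop :=
  (P 0%nat - C 0%nat) ^ 2 + (P 1%nat - C 1%nat) ^ 2 + (P 2%nat - C 2%nat) ^ 2 = r ^ 2.

(* Main.v *)
Require Import Defs.
From Stdlib Require Import Reals Lra.
From Coquelicot Require Import Coquelicot.
Open Scope R_scope.

(** Write [c = p'], [s = q'], [k] for the curvature of the profile curve, [lam = A 0 0] and
    [mu = A 2 2]. Resolved along the normal and the tangent of the profile, the matrix
    equation becomes [lam p s - mu q c = 2] and
    [k' / (2 k^2) - c / (2 k p) + c / (2 s) = T] with [T = lam p c + mu q s].
    Differentiating the first gives [k T = - (lam - mu) c s].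
    If [lam = mu], then [(p^2 + q^2)' = 0] and the profile is a circle. If [mu = 0], then
    [p s] is constant, which characterizes the catenary. Otherwise, differentiating
    [k T = - (lam - mu) c s] and using the tangent equation yields an algebraic relation
    between [p] and [s] that factors as [(lam p - s) G(p, s) = 0]. The first factor cannot
    vanish on an interval; where it does not vanish, [G = 0] and its derivative force
    [(lam - mu) p s = 2 = lam p s], hence [mu = 0]. The value [lam = 0] is excluded
    separately, since [lam] is used as a divisor. *)

(** * Neighbourhoods and the differentiation of identities on an interval *)

Lemma locally_open_interval (a b u : R) :
  a < u < b -> locally u (fun t => a < t < b).
Proof.
  intros hu.
  apply (locally_open (fun t => a < t < b) (fun t => a < t < b)); [| easy | exact hu].
  apply open_and; [apply open_gt | apply open_lt].
Qed.

Lemma locally_imp2 (u : R) (P Q W : R -> Prop) :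
  (forall t, P t -> Q t -> W t) -> locally u P -> locally u Q -> locally u W.
Proof.
  intros himp hP hQ. generalize (filter_and _ _ hP hQ).
  apply filter_imp. intros t [h1 h2]. now apply himp.
Qed.

Lemma locally_imp3 (u : R) (P Q V W : R -> Prop) :
  (forall t, P t -> Q t -> V t -> W t) ->
  locally u P -> locally u Q -> locally u V -> locally u W.
Proof.
  intros himp hP hQ. apply locally_imp2 with (2 := filter_and _ _ hP hQ).
  intros t [h1 h2]. now apply himp.
Qed.

(** The device for differentiating an identity that holds near a point: [f] is the difference of its
    two sides, [l] its formal derivative. *)
Lemma is_derive_locally_zero (f : R -> R) (u l : R) :
  is_derive f u l -> locally u (fun t => f t = 0) -> l = 0.
Proof.
  intros hf h0.
  rewrite <- (is_derive_unique _ _ _ hf), (Derive_ext_loc f (fun _ => 0) u h0).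
  apply Derive_const.
Qed.

(** By continuity; it allows a factor to be cancelled near a point before an identity is
    differentiated there. *)
Lemma is_derive_locally_neq0 (f : R -> R) (u l : R) :
  is_derive f u l -> f u <> 0 -> locally u (fun t => f t <> 0).
Proof.
  intros hf hn.
  assert (hc : continuous f u)
    by (apply (ex_derive_continuous (K := R_AbsRing) (V := R_NormedModule)); now exists l).
  apply (hc (fun y : R => y <> 0)).
  apply (locally_open (fun y : R => y <> 0) (fun y : R => y <> 0));
    [apply open_neq | easy | exact hn].
Qed.

Lemma derive_zero_const (f : R -> R) (a b : R) :
  (forall u, a < u < b -> is_derive f u 0) ->
  forall u w, a < u < b -> a < w < b -> f u = f w.
Proof.
  intros hf u w hu hw.
  destruct (Rtotal_order u w) as [h | [h | h]].
  - apply eq_is_derive; [| exact h]. intros t ht. apply hf. lra.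
  - now rewrite h.
  - symmetry. apply eq_is_derive; [| exact h]. intros t ht. apply hf. lra.
Qed.

(** * The profile curve and the spectral equations along it *)

(* [c], [s] are the components of the unit tangent and [k] is the curvature of
   the profile curve [(p, q)]; the derivatives of [c] and [s] are the Frenet equations. *)
Record arc_profile (a b : R) (p q c s k : R -> R) : Prop := {
  prof_p : forall u, a < u < b -> is_derive p u (c u);
  prof_q : forall u, a < u < b -> is_derive q u (s u);
  prof_c : forall u, a < u < b -> is_derive c u (- k u * s u);
  prof_s : forall u, a < u < b -> is_derive s u (k u * c u);
  prof_pos : forall u, a < u < b -> 0 < p u;
  prof_unit : forall u, a < u < b -> c u ^ 2 + s u ^ 2 = 1;
  prof_s_neq0 : forall u, a < u < b -> s u <> 0;
  prof_k_neq0 : forall u, a < u < b -> k u <> 0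
}.

(* [rewrite] would try to unify derivatives of distinct functions by unfolding [Derive]. *)
Ltac subst_derive f h :=
  let E := fresh in
  match type of h with is_derive _ ?u ?l =>
    assert (E : Derive (fun x : R => f x) u = l) by exact (is_derive_unique _ _ _ h);
    revert E; generalize (Derive (fun x : R => f x) u); intros ? ->
  end.

(** Differentiates an expression along the profile and inserts the Frenet equations.
    Differentiability of any other function, such as [k], is left as a goal. *)
Ltac profile_derive H hu :=
  let Hp := fresh in let Hq := fresh in let Hc := fresh in let Hs := fresh in
  pose proof (prof_p _ _ _ _ _ _ _ H _ hu) as Hp;
  pose proof (prof_q _ _ _ _ _ _ _ H _ hu) as Hq;
  pose proof (prof_c _ _ _ _ _ _ _ H _ hu) as Hc;
  pose proof (prof_s _ _ _ _ _ _ _ H _ hu) as Hs;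
  match type of H with arc_profile _ _ ?p ?q ?c ?s _ =>
    auto_derive;
    [ repeat split;
      try match goal with
      | |- ex_derive (fun x => p x) _ => eexists; exact Hp
      | |- ex_derive (fun x => q x) _ => eexists; exact Hq
      | |- ex_derive (fun x => c x) _ => eexists; exact Hc
      | |- ex_derive (fun x => s x) _ => eexists; exact Hs
      end
    | subst_derive p Hp; subst_derive q Hq; subst_derive c Hc; subst_derive s Hs ]
  end;
  clear Hp Hq Hc Hs.

(* The two equations [Delta^II x = A x] solved for their components along the
   normal and the tangent of the profile curve. *)
Record spectral_profile (a b lam mu : R) (p q c s k : R -> R) : Prop := {
  spec_normal : forall u, a < u < b -> lam * p u * s u - mu * q u * c u = 2;
  spec_tangent : forall u, a < u < b ->
    is_derive k u (k u ^ 2 * (2 * (lam * p u * c u + mu * q u * s u)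
                              + c u / (k u * p u) - c u / s u))
}.

(* [lra] treats nonlinear monomials as atoms, so polynomial identities modulo
   hypotheses are closed by supplying the cofactors. *)
Ltac scale e x := generalize (f_equal (Rmult x) e).

(** * First consequences of the spectral equations *)

Lemma locally_of_interval (a b u : R) (P : R -> Prop) :
  a < u < b -> (forall t, a < t < b -> P t) -> locally u P.
Proof.
  intros hu hP. generalize (locally_open_interval a b u hu). now apply filter_imp.
Qed.

(** Otherwise [c' = - k s] would vanish too, against [k <> 0] and [s <> 0]. *)
Lemma profile_c_not_locally_zero a b p q c s k (H : arc_profile a b p q c s k) u :
  a < u < b -> ~ locally u (fun t => c t = 0).
Proof.
  intros hu h0.
  generalize (is_derive_locally_zero _ _ _ (prof_c _ _ _ _ _ _ _ H u hu) h0).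
  generalize (prof_s_neq0 _ _ _ _ _ _ _ H u hu) (prof_k_neq0 _ _ _ _ _ _ _ H u hu).
  intros hs hk h. apply Rmult_integral in h. destruct h; lra.
Qed.

Lemma profile_c_neq0_somewhere a b p q c s k (H : arc_profile a b p q c s k) :
  a < b -> exists u, a < u < b /\ c u <> 0.
Proof.
  intros hab. apply Classical_Prop.NNPP. intros hn.
  assert (hm : a < (a + b) / 2 < b) by lra.
  apply (profile_c_not_locally_zero _ _ _ _ _ _ _ H _ hm).
  apply (locally_of_interval a b); [exact hm |].
  intros t ht. apply Classical_Prop.NNPP. intros hc. apply hn. now exists t.
Qed.

(* Differentiate the normal equation. *)
Lemma spectral_curvature a b lam mu p q c s k
    (H : arc_profile a b p q c s k) (S : spectral_profile a b lam mu p q c s k) u :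
  a < u < b ->
  k u * (lam * p u * c u + mu * q u * s u) = - (lam - mu) * c u * s u.
Proof.
  intros hu.
  assert (hd : is_derive (fun t => lam * p t * s t - mu * q t * c t - 2) u
     (k u * (lam * p u * c u + mu * q u * s u) + (lam - mu) * c u * s u)).
  { profile_derive H hu. ring. }
  apply is_derive_locally_zero in hd; [lra |].
  apply (locally_of_interval a b); [exact hu |].
  intros t ht. rewrite (spec_normal _ _ _ _ _ _ _ _ _ S t ht). ring.
Qed.

(** If [lam = 0], the normal equation gives [mu q c = -2], and the curvature identity reduces to
    [k q = c]. Differentiating gives [p (1 + s^2) = c q s], and differentiating again [s + p k = 0].
    Then [p c + q s = 0], which turns the former relation into [2 p = 0]. *)
Lemma spectral_lam_neq0 a b lam mu p q c s k
    (H : arc_profile a b p q c s k) (S : spectral_profile a b lam mu p q c s k) :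
  a < b -> lam <> 0.
Proof.
  intros hab hlam. subst lam.
  assert (hkq : forall u, a < u < b -> k u * q u - c u = 0).
  { intros u hu.
    generalize (spectral_curvature _ _ _ _ _ _ _ _ _ H S u hu)
      (spec_normal _ _ _ _ _ _ _ _ _ S u hu) (prof_s_neq0 _ _ _ _ _ _ _ H u hu).
    intros h1 h2 h3.
    assert (hmu : mu <> 0) by (intros ->; lra).
    apply (Rmult_eq_reg_l (mu * s u)); [lra |].
    apply Rmult_integral_contrapositive; easy. }
  assert (hc : forall u, a < u < b -> c u <> 0).
  { intros u hu h. generalize (spec_normal _ _ _ _ _ _ _ _ _ S u hu). rewrite h. lra. }
  assert (hrel : forall u, a < u < b ->
    p u * (1 + s u ^ 2) - c u * q u * s u = 0).
  { intros u hu.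
    generalize (spec_normal _ _ _ _ _ _ _ _ _ S u hu) (prof_s_neq0 _ _ _ _ _ _ _ H u hu)
      (prof_k_neq0 _ _ _ _ _ _ _ H u hu) (prof_pos _ _ _ _ _ _ _ H u hu)
      (prof_unit _ _ _ _ _ _ _ H u hu) (hkq u hu) (hc u hu)
      (spec_tangent _ _ _ _ _ _ _ _ _ S u hu).
    set (k1 := k u ^ 2 * _). intros h1 hs hk hp hunit h2 hcu hk1.
    assert (hd : is_derive (fun t => k t * q t - c t) u (k1 * q u + 2 * k u * s u)).
    { profile_derive H hu.
      - now exists k1.
      - subst_derive k hk1. ring. }
    apply is_derive_locally_zero in hd; [| now apply (locally_of_interval a b)].
    assert (hp0 : p u <> 0) by lra.
    assert (e : k1 * (p u * s u)
        = k u * (2 * k u * (mu * q u * s u) * p u * s u + c u * s u - k u * c u * p u)).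
    { unfold k1. field. auto. }
    assert (e2 : q u * (2 * k u * (mu * q u * s u) * p u * s u + c u * s u - k u * c u * p u)
                 + 2 * s u * (p u * s u) = 0).
    { apply (Rmult_eq_reg_l (k u)); [| exact hk].
      scale hd (p u * s u). scale e (q u). lra. }
    clear e hd hk1. clearbody k1.
    (* Insert [k q = c], [mu q c = -2] and [c^2 + s^2 = 1] into [e2]. *)
    scale h2 (2 * mu * q u * s u ^ 2 * p u - c u * p u). scale h1 (2 * s u ^ 2 * p u).
    scale hunit (p u). lra. }
  destruct (profile_c_neq0_somewhere _ _ _ _ _ _ _ H hab) as [u [hu _]].
  assert (hd : is_derive (fun t => p t * (1 + s t ^ 2) - c t * q t * s t) u
    (c u * (1 + s u ^ 2) + 2 * p u * s u * (k u * c u)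
      + k u * s u * q u * s u - c u * s u * s u - c u * q u * (k u * c u))).
  { profile_derive H hu. ring. }
  apply is_derive_locally_zero in hd; [| now apply (locally_of_interval a b)].
  generalize (prof_s_neq0 _ _ _ _ _ _ _ H u hu)
      (prof_k_neq0 _ _ _ _ _ _ _ H u hu) (prof_pos _ _ _ _ _ _ _ H u hu)
      (prof_unit _ _ _ _ _ _ _ H u hu) (hkq u hu) (hc u hu) (hrel u hu).
  intros hs hk hp hunit e hcu er.
  (* With [k q = c] the derivative in [hd] becomes [2 c s (s + p k)]. *)
  assert (e1 : s u + p u * k u = 0).
  { apply (Rmult_eq_reg_l (2 * c u * s u)); [scale e (s u ^ 2 - c u ^ 2); scale hunit (c u); lra |].
    repeat apply Rmult_integral_contrapositive_currified; lra. }
  assert (e2 : p u * c u + q u * s u = 0).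
  { apply (Rmult_eq_reg_l (k u)); [scale e1 (c u); scale e (s u); lra | exact hk]. }
  scale e2 (c u). scale hunit (p u). lra.
Qed.

(** * The algebraic relation between [p] and [s], and the vanishing of [mu] *)

(** Differentiate the curvature identity, then eliminate [k'] by the tangent equation, [k] by
    [k T = - (lam - mu) c s], and finally [T] by [T c = lam p - 2 s], a consequence of the normal
    equation. *)
Lemma spectral_factorization a b lam mu p q c s k
    (H : arc_profile a b p q c s k) (S : spectral_profile a b lam mu p q c s k) u :
  a < u < b -> lam <> mu -> c u <> 0 ->
  (lam * p u - s u) *
  ((lam - mu) * lam * p u ^ 2 * s u - (lam - mu) * p u * s u ^ 2
    - (2 * lam - mu) * p u + 2 * s u) = 0.
Proof.
  intros hu hlm hc.
  generalize (spectral_curvature _ _ _ _ _ _ _ _ _ H S u hu)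
    (spec_normal _ _ _ _ _ _ _ _ _ S u hu) (spec_tangent _ _ _ _ _ _ _ _ _ S u hu)
    (prof_s_neq0 _ _ _ _ _ _ _ H u hu) (prof_k_neq0 _ _ _ _ _ _ _ H u hu)
    (prof_pos _ _ _ _ _ _ _ H u hu) (prof_unit _ _ _ _ _ _ _ H u hu).
  set (k1 := k u ^ 2 * _). intros e1 e2 hk1 hs hk hp hunit.
  assert (hp0 : p u <> 0) by lra.
  set (T := lam * p u * c u + mu * q u * s u) in *.
  (* The normal equation gives [T' = lam c^2 + mu s^2 - 2 k]. *)
  assert (hd : is_derive (fun t => k t * (lam * p t * c t + mu * q t * s t)
                                   + (lam - mu) * c t * s t) u
    (k1 * T + k u * (lam * c u ^ 2 + mu * s u ^ 2 - 2 * k u)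
      + (lam - mu) * k u * (c u ^ 2 - s u ^ 2))).
  { profile_derive H hu.
    - now exists k1.
    - subst_derive k hk1. rewrite <- e2. unfold T. ring. }
  apply is_derive_locally_zero in hd.
  2: { apply (locally_of_interval a b); [exact hu |].
       intros t ht. rewrite (spectral_curvature _ _ _ _ _ _ _ _ _ H S t ht). ring. }
  assert (ek : k1 * (p u * s u) =
    k u * (2 * k u * T * p u * s u + c u * s u - k u * c u * p u)).
  { unfold k1. field. auto. }
  assert (ep : lam * p u = 2 * s u + T * c u) 
    by (unfold T; scale hunit (lam * p u); scale e2 (s u); lra).
  clear hk1 e2. clearbody k1 T.
  assert (e3 : T * (2 * k u * T * p u * s u + c u * s u - k u * c u * p u)
     + (p u * s u) * (lam * c u ^ 2 + mu * s u ^ 2 - 2 * k u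
          + (lam - mu) * (c u ^ 2 - s u ^ 2)) = 0).
  { apply (Rmult_eq_reg_l (k u)); [| exact hk].
    transitivity ((k1 * T + k u * (lam * c u ^ 2 + mu * s u ^ 2 - 2 * k u)
      + (lam - mu) * k u * (c u ^ 2 - s u ^ 2)) * (p u * s u)
      - T * (k1 * (p u * s u) - k u * (2 * k u * T * p u * s u + c u * s u - k u * c u * p u)));
      [ring | rewrite hd, ek; ring]. }
  (* Multiplying [e3] by [T] makes [k] appear only in the product [k T], which is known; a factor
     [s] is then cancelled. *)
  assert (e4 : - 2 * (lam - mu) * c u * s u * T ^ 2 * p u + T ^ 2 * c u
     + p u * (T * (2 * (lam - mu) * c u ^ 2 + lam * c u ^ 2 + mu * s u ^ 2
              - (lam - mu) * s u ^ 2) + 2 * (lam - mu) * c u * s u) = 0).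
  { apply (Rmult_eq_reg_l (s u)); [| exact hs].
    transitivity (T * (T * (2 * (k u * T) * p u * s u + c u * s u) - (k u * T) * c u * p u
     + (p u * s u) * (lam * c u ^ 2 + mu * s u ^ 2
          + (lam - mu) * (c u ^ 2 - s u ^ 2))) - 2 * (k u * T) * (p u * s u));
      [rewrite e1; ring |].
    rewrite Rmult_0_r, <- (Rmult_0_r T), <- e3. ring. }
  (* Since [T c = Z], the product of [e4] with [c] is polynomial in [p] and [s]; it equals [-2]
     times the factored expression. *)
  apply (Rmult_eq_reg_l (-2)); [| lra].
  set (Z := lam * p u - 2 * s u).
  assert (eZ : Z = T * c u) by (unfold Z; lra).
  transitivity (Z ^ 2 * (1 - 2 * (lam - mu) * s u * p u)
    + p u * Z * (2 * (lam - mu) + lam - 4 * (lam - mu) * s u ^ 2)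
    + 2 * (lam - mu) * (1 - s u ^ 2) * s u * p u);
    [unfold Z; ring |].
  replace (1 - s u ^ 2) with (c u ^ 2) by lra.
  replace (2 * (lam - mu) + lam - 4 * (lam - mu) * s u ^ 2) with
    (2 * (lam - mu) * c u ^ 2 + lam * c u ^ 2 + mu * s u ^ 2 - (lam - mu) * s u ^ 2)
    by (transitivity ((2 * (lam - mu) + lam) * (c u ^ 2 + s u ^ 2)
          - 4 * (lam - mu) * s u ^ 2); [ring | rewrite hunit; ring]).
  rewrite eZ, Rmult_0_r, <- (Rmult_0_r (c u)), <- e4. ring.
Qed.

(* On an open set where [lam * p = s], differentiation gives [k = lam] and then
   [lam = (lam - mu) * c ^ 2], so that [c] is locally constant. *)
Lemma spectral_not_locally_first_factor a b lam mu p q c s k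
    (H : arc_profile a b p q c s k) (S : spectral_profile a b lam mu p q c s k) u :
  a < u < b -> lam <> mu -> c u <> 0 -> ~ locally u (fun t => lam * p t - s t = 0).
Proof.
  intros hu hlm hc hloc.
  assert (hcloc := is_derive_locally_neq0 _ _ _ (prof_c _ _ _ _ _ _ _ H u hu) hc).
  assert (hl : locally u (fun t => lam - (lam - mu) * c t ^ 2 = 0)).
  { generalize (locally_locally _ _ hloc) hcloc (locally_open_interval a b u hu).
    apply locally_imp3. intros t hlt hct ht.
    generalize (spectral_curvature _ _ _ _ _ _ _ _ _ H S t ht)
      (spec_normal _ _ _ _ _ _ _ _ _ S t ht)
      (prof_s_neq0 _ _ _ _ _ _ _ H t ht) (prof_k_neq0 _ _ _ _ _ _ _ H t ht)
      (prof_unit _ _ _ _ _ _ _ H t ht) (locally_singleton _ _ hlt).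
    intros e1 e2 hs hk hunit e3.
    assert (hd : is_derive (fun t => lam * p t - s t) t (lam * c t - k t * c t)).
    { profile_derive H ht. ring. }
    apply is_derive_locally_zero in hd; [| exact hlt].
    assert (ek : k t = lam).
    { apply (Rmult_eq_reg_l (c t)); [lra | exact hct]. }
    assert (ep : (lam * p t * c t + mu * q t * s t) * c t = lam * p t - 2 * s t)
      by (scale hunit (lam * p t); scale e2 (s t); lra).
    apply (Rmult_eq_reg_l (s t)); [| exact hs].
    rewrite ek in e1. scale e1 (c t). scale ep lam. scale e3 lam. lra. }
  assert (hd : is_derive (fun t => lam - (lam - mu) * c t ^ 2) u
      (2 * (lam - mu) * c u * (k u * s u))).
  { profile_derive H hu. ring. }
  apply is_derive_locally_zero in hd; [| exact hl].
  revert hd. repeat apply Rmult_integral_contrapositive_currified;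
    try lra; try exact hc;
    [apply (prof_k_neq0 _ _ _ _ _ _ _ H u hu) | apply (prof_s_neq0 _ _ _ _ _ _ _ H u hu)].
Qed.

(** Near a suitable point [G = 0]. The derivative of [G] is [c] times an expression affine in [k];
    multiplying by [Z = T c] removes [k] through [k Z = - (lam - mu) s c^2], which leaves two
    polynomial equations in [p] and [s]. *)
Lemma spectral_mu_eq0 a b lam mu p q c s k
    (H : arc_profile a b p q c s k) (S : spectral_profile a b lam mu p q c s k) :
  a < b -> lam <> mu -> mu = 0.
Proof.
  intros hab hlm.
  destruct (profile_c_neq0_somewhere _ _ _ _ _ _ _ H hab) as [u0 [hu0 hc0]].
  assert (hc0loc := is_derive_locally_neq0 _ _ _ (prof_c _ _ _ _ _ _ _ H u0 hu0) hc0).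
  (* If [lam p - s] vanished wherever [c] does not, it would vanish near [u0]. *)
  assert (hex : exists u, a < u < b /\ c u <> 0 /\ lam * p u - s u <> 0).
  { apply Classical_Prop.NNPP. intros hn.
    apply (spectral_not_locally_first_factor _ _ _ _ _ _ _ _ _ H S u0 hu0 hlm hc0).
    generalize hc0loc (locally_open_interval a b u0 hu0).
    apply locally_imp2. intros t hct ht. apply Classical_Prop.NNPP. intros hf.
    apply hn. now exists t. }
  destruct hex as [u [hu [hc hf]]].
  assert (hcloc := is_derive_locally_neq0 _ _ _ (prof_c _ _ _ _ _ _ _ H u hu) hc).
  assert (hfloc : locally u (fun t => lam * p t - s t <> 0)).
  { apply (is_derive_locally_neq0 (fun t => lam * p t - s t) u (lam * c u - k u * c u));
      [profile_derive H hu; ring | exact hf]. }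
  set (G := fun t => (lam - mu) * lam * p t ^ 2 * s t - (lam - mu) * p t * s t ^ 2
    - (2 * lam - mu) * p t + 2 * s t).
  assert (hG : locally u (fun t => G t = 0)).
  { generalize hcloc hfloc (locally_open_interval a b u hu).
    apply locally_imp3. intros t hct hft ht.
    generalize (spectral_factorization _ _ _ _ _ _ _ _ _ H S t ht hlm hct).
    intros e. apply Rmult_integral in e. now destruct e. }
  assert (hd : is_derive G u
    (c u * (2 * (lam - mu) * lam * p u * s u + (lam - mu) * lam * p u ^ 2 * k u
      - (lam - mu) * s u ^ 2 - 2 * (lam - mu) * p u * s u * k u
      - (2 * lam - mu) + 2 * k u))).
  { unfold G. profile_derive H hu. ring. }
  apply is_derive_locally_zero in hd; [| exact hG].
  apply Rmult_integral in hd. destruct hd as [hd | hd]; [contradiction |].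
  apply locally_singleton in hG. unfold G in hG.
  generalize (spectral_curvature _ _ _ _ _ _ _ _ _ H S u hu)
    (spec_normal _ _ _ _ _ _ _ _ _ S u hu)
    (prof_s_neq0 _ _ _ _ _ _ _ H u hu)
    (prof_pos _ _ _ _ _ _ _ H u hu) (prof_unit _ _ _ _ _ _ _ H u hu).
  intros e1 e2 hs hp hunit.
  assert (ep : (lam * p u * c u + mu * q u * s u) * c u = lam * p u - 2 * s u)
    by (scale hunit (lam * p u); scale e2 (s u); lra).
  set (Z := lam * p u - 2 * s u) in *.
  assert (ekZ : k u * Z = - (lam - mu) * s u * c u ^ 2).
  { rewrite <- ep, <- Rmult_assoc, e1. ring. }
  assert (hdel : lam - mu <> 0) by lra.
  assert (hp0 : p u <> 0) by lra.
  assert (hZ : Z <> 0).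
  { intros h. rewrite h, Rmult_0_r in ekZ. symmetry in ekZ. revert ekZ.
    repeat apply Rmult_integral_contrapositive_currified;
      try exact hs; try exact hc; lra. }
  (* This is [G = 0] rewritten through [Z]. *)
  assert (eZ : Z * ((lam - mu) * p u * s u - 1) = (lam - mu) * p u * c u ^ 2).
  { replace (c u ^ 2) with (1 - s u ^ 2) by lra.
    unfold Z. lra. }
  assert (e3 : (2 * (lam - mu) * lam * p u * s u - (lam - mu) * s u ^ 2 - (2 * lam - mu)) * Z
     - (lam - mu) * s u * c u ^ 2 * ((lam - mu) * lam * p u ^ 2 - 2 * (lam - mu) * p u * s u + 2)
     = 0).
  { transitivity (Z * (2 * (lam - mu) * lam * p u * s u + (lam - mu) * lam * p u ^ 2 * k u
      - (lam - mu) * s u ^ 2 - 2 * (lam - mu) * p u * s u * k u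
      - (2 * lam - mu) + 2 * k u)); [| rewrite hd; ring].
    transitivity ((2 * (lam - mu) * lam * p u * s u - (lam - mu) * s u ^ 2 - (2 * lam - mu)) * Z
     + (k u * Z) * ((lam - mu) * lam * p u ^ 2 - 2 * (lam - mu) * p u * s u + 2));
     [rewrite ekZ | unfold Z]; ring. }
  (* A combination of [p] times [e3], [Z] times [G = 0] and a multiple of [eZ] in which all but one
     product cancels. *)
  assert (e4 : (lam - mu) * s u * p u * Z ^ 2 * (2 - (lam - mu) * p u * s u) = 0).
  { transitivity (p u * ((2 * (lam - mu) * lam * p u * s u - (lam - mu) * s u ^ 2 - (2 * lam - mu)) * Z
     - (lam - mu) * s u * c u ^ 2 * ((lam - mu) * lam * p u ^ 2 - 2 * (lam - mu) * p u * s u + 2))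
     - Z * ((lam - mu) * lam * p u ^ 2 * s u - (lam - mu) * p u * s u ^ 2
         - (2 * lam - mu) * p u + 2 * s u)
     - s u * ((lam - mu) * p u * Z + 2)
       * (Z * ((lam - mu) * p u * s u - 1) - (lam - mu) * p u * c u ^ 2));
     [unfold Z; ring | rewrite e3, hG, eZ; ring]. }
  assert (e5 : (lam - mu) * p u * s u = 2).
  { apply Rmult_integral in e4. destruct e4 as [e4 | e4]; [exfalso; revert e4 | lra].
    repeat apply Rmult_integral_contrapositive_currified; try assumption; lra. }
  (* By [e5], [eZ] reads [Z = (lam - mu) p c^2], so [s Z = 2 c^2]. Subtracting [e5] from the
     resulting [e6] leaves [mu p s = 0]. *)
  assert (e6 : lam * p u * s u = 2).
  { rewrite e5 in eZ.
    assert (e7 : s u * Z = 2 * c u ^ 2) by (transitivity (c u ^ 2 * ((lam - mu) * p u * s u));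
      [transitivity (s u * (Z * (2 - 1))); [ring | rewrite eZ; ring] | rewrite e5; ring]).
    unfold Z in e7. lra. }
  apply (Rmult_eq_reg_r (p u * s u)); [lra |].
  apply Rmult_integral_contrapositive_currified; assumption.
Qed.

(** * Integration of the profile: circle and catenary *)

(** The curvature identity becomes [k lam (p c + q s) = 0], and [p c + q s] is half the derivative
    of [p^2 + q^2]. *)
Lemma spectral_sphere a b lam mu p q c s k
    (H : arc_profile a b p q c s k) (S : spectral_profile a b lam mu p q c s k) :
  a < b -> lam = mu ->
  exists r, 0 < r /\ forall u, a < u < b -> p u ^ 2 + q u ^ 2 = r ^ 2.
Proof.
  intros hab hlm.
  assert (hlam := spectral_lam_neq0 _ _ _ _ _ _ _ _ _ H S hab).
  assert (hm : a < (a + b) / 2 < b) by lra.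
  assert (hd : forall u, a < u < b -> is_derive (fun t => p t ^ 2 + q t ^ 2) u 0).
  { intros u hu.
    generalize (spectral_curvature _ _ _ _ _ _ _ _ _ H S u hu)
      (prof_k_neq0 _ _ _ _ _ _ _ H u hu). intros e hk.
    assert (e2 : p u * c u + q u * s u = 0).
    { apply (Rmult_eq_reg_l (k u * lam)); [rewrite <- hlm in e; lra |].
      apply Rmult_integral_contrapositive; easy. }
    profile_derive H hu. lra. }
  assert (hpos : 0 < p ((a + b) / 2) ^ 2 + q ((a + b) / 2) ^ 2).
  { generalize (prof_pos _ _ _ _ _ _ _ H _ hm). intros h. nra. }
  exists (sqrt (p ((a + b) / 2) ^ 2 + q ((a + b) / 2) ^ 2)).
  split; [now apply sqrt_lt_R0 |].
  intros u hu. rewrite pow2_sqrt by lra.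
  now apply (derive_zero_const (fun t => p t ^ 2 + q t ^ 2) a b).
Qed.

(** The constant [C = p s] has the sign of [q'], while the scale of a catenoid is positive; evenness
    of [cosh] reconciles the two. *)
Lemma cosh_div_Rabs (x y : R) : cosh (x / Rabs y) = cosh (x / y).
Proof.
  unfold Rabs. destruct (Rcase_abs y) as [h | h]; [| reflexivity].
  replace (x / - y) with (- (x / y)) by (field; lra).
  unfold cosh. rewrite Ropp_involutive. lra.
Qed.

Lemma spectral_catenoid a b lam p q c s k
    (H : arc_profile a b p q c s k) (S : spectral_profile a b lam 0 p q c s k) :
  a < b ->
  exists r d, 0 < r /\ forall u, a < u < b -> p u = r * cosh ((q u - d) / r).
Proof.
  intros hab.
  assert (hlam := spectral_lam_neq0 _ _ _ _ _ _ _ _ _ H S hab).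
  assert (hps : forall u, a < u < b -> p u * s u = 2 / lam).
  { intros u hu. generalize (spec_normal _ _ _ _ _ _ _ _ _ S u hu). intros e.
    apply (Rmult_eq_reg_l lam); [field_simplify; lra | exact hlam]. }
  set (C := 2 / lam) in *.
  assert (hm : a < (a + b) / 2 < b) by lra.
  assert (hC : C <> 0).
  { rewrite <- (hps _ hm). apply Rmult_integral_contrapositive_currified;
      [apply Rgt_not_eq, (prof_pos _ _ _ _ _ _ _ H _ hm)
      | apply (prof_s_neq0 _ _ _ _ _ _ _ H _ hm)]. }
  assert (hc1 : forall u, a < u < b -> 0 < 1 + c u).
  { intros u hu. generalize (prof_unit _ _ _ _ _ _ _ H u hu) (prof_s_neq0 _ _ _ _ _ _ _ H u hu).
    intros e hs. assert (0 < s u ^ 2) by (apply pow2_gt_0; exact hs). nra. }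
  assert (hcs : forall u, a < u < b -> c u * (s u + p u * k u) = 0).
  { intros u hu.
    assert (hd : is_derive (fun t => p t * s t - C) u (c u * (s u + p u * k u)))
      by (profile_derive H hu; ring).
    apply is_derive_locally_zero in hd; [exact hd |].
    apply (locally_of_interval a b); [exact hu |]. intros t ht. rewrite hps; [ring | exact ht]. }
  (* By continuity a nonzero value of [s + p k] would persist nearby and force [c = 0] there. *)
  assert (hk : forall u, a < u < b -> s u + p u * k u = 0).
  { intros u hu.
    destruct (Req_dec (s u + p u * k u) 0) as [h | h]; [exact h | exfalso].
    apply (profile_c_not_locally_zero _ _ _ _ _ _ _ H u hu).
    generalize (spec_tangent _ _ _ _ _ _ _ _ _ S u hu).
    set (k1 := k u ^ 2 * _). intros hk1.
    assert (hd : is_derive (fun t => s t + p t * k t) u (2 * k u * c u + p u * k1)).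
    { profile_derive H hu; [now exists k1 |]. subst_derive k hk1. ring. }
    generalize (is_derive_locally_neq0 _ _ _ hd h) (locally_open_interval a b u hu).
    apply locally_imp2. intros t h1 ht.
    generalize (hcs t ht). intros e. apply Rmult_integral in e. now destruct e. }
  assert (hw : forall u, a < u < b -> 0 < p u * (1 + c u)).
  { intros u hu. apply Rmult_lt_0_compat; [apply (prof_pos _ _ _ _ _ _ _ H u hu) | auto]. }
  (* Integrates the profile: [p (1 + c) = exp (q / C + e0)], while
     [p (1 + c) * p (1 - c) = (p s)^2 = C^2] recovers [p (1 - c)]. *)
  assert (hd : forall u, a < u < b -> is_derive (fun t => ln (p t * (1 + c t)) - q t / C) u 0).
  { intros u hu.
    generalize (prof_pos _ _ _ _ _ _ _ H u hu) (hc1 u hu) (hk u hu) (hps u hu)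
      (prof_unit _ _ _ _ _ _ _ H u hu) (hw u hu) (prof_s_neq0 _ _ _ _ _ _ _ H u hu).
    intros hp h1 e1 e2 e3 h2 hs.
    profile_derive H hu.
    - assumption.
    - transitivity ((c u * (1 + c u) - (p u * k u) * s u) / (p u * (1 + c u)) - s u / C);
        [field; repeat split; lra |].
      replace (p u * k u) with (- s u) by lra.
      replace (c u * (1 + c u) - - s u * s u) with (1 + c u) by lra.
      rewrite <- e2. field. repeat split; lra. }
  set (e0 := ln (p ((a + b) / 2) * (1 + c ((a + b) / 2))) - q ((a + b) / 2) / C).
  assert (hA : 0 < Rabs C) by now apply Rabs_pos_lt.
  (* The shift [d] is chosen so that [exp ((q - d) / C) = p (1 + c) / Rabs C]. *)
  exists (Rabs C), (C * (ln (Rabs C) - e0)).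
  split; [exact hA |].
  intros u hu. rewrite cosh_div_Rabs.
  assert (e1 := derive_zero_const _ a b hd u _ hu hm). cbv beta in e1. fold e0 in e1.
  replace ((q u - C * (ln (Rabs C) - e0)) / C) with (ln (p u * (1 + c u)) - ln (Rabs C))
    by (rewrite <- e1; field; exact hC).
  unfold cosh. rewrite Ropp_minus_distr. unfold Rminus.
  rewrite !exp_plus, !exp_Ropp, !exp_ln by auto.
  generalize (hps u hu) (prof_unit _ _ _ _ _ _ _ H u hu) (hw u hu) (hc1 u hu)
    (prof_pos _ _ _ _ _ _ _ H u hu).
  intros e2 e3 hwu h1 hp.
  transitivity ((p u * (1 + c u) + Rabs C ^ 2 / (p u * (1 + c u))) / 2);
    [| field; repeat split; lra].
  rewrite pow2_abs, <- e2.
  replace ((p u * s u) ^ 2) with (p u ^ 2 * ((1 + c u) * (1 - c u)))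
    by (replace ((1 + c u) * (1 - c u)) with (s u ^ 2) by lra; ring).
  field. split; lra.
Qed.

(** * Derivatives and second fundamental form of a surface of revolution *)

(** The azimuthal field of length [|f|]. Up to sign, the [v]-derivative exchanges such fields with
    the radial ones [surf_rev f (fun _ => 0)], so these families express all partial derivatives of
    the surface. *)
Definition rot_field (f : R -> R) (k : nat) (u v : R) : R :=
  match k with
  | O => - (f u * sin v)
  | 1%nat => f u * cos v
  | _ => 0
  end.

Lemma pd_u_surf_rev p q k u v :
  pd 0 (surf_rev p q k) u v = surf_rev (Derive p) (Derive q) k u v.
Proof.
  unfold pd, surf_rev. destruct k as [| [| k]].
  - apply (Derive_scal_l p).
  - apply (Derive_scal_l p).
  - reflexivity.
Qed.

Lemma is_derive_v_surf_rev p q k u v :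
  is_derive (fun t => surf_rev p q k u t) v (rot_field p k u v).
Proof.
  unfold rot_field, surf_rev. destruct k as [| [| k]]; auto_derive; trivial; ring.
Qed.

Lemma pd_v_surf_rev p q k u v : pd 1 (surf_rev p q k) u v = rot_field p k u v.
Proof. apply is_derive_unique, is_derive_v_surf_rev. Qed.

Lemma pd_u_rot_field f k u v : pd 0 (rot_field f k) u v = rot_field (Derive f) k u v.
Proof.
  unfold pd, rot_field. destruct k as [| [| k]].
  - rewrite Derive_opp. f_equal. apply (Derive_scal_l f).
  - apply (Derive_scal_l f).
  - apply Derive_const.
Qed.

Lemma is_derive_v_rot_field f k u v :
  is_derive (fun t => rot_field f k u t) v (- surf_rev f (fun _ => 0) k u v).
Proof.
  unfold rot_field, surf_rev. destruct k as [| [| k]]; auto_derive; trivial; ring.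
Qed.

Lemma pd_ext i f g u v : (forall u v, f u v = g u v) -> pd i f u v = pd i g u v.
Proof. intros h. destruct i; apply Derive_ext; auto. Qed.

Lemma xdd_uu p q u v k :
  xdd (surf_rev p q) 0 0 u v k = surf_rev (Derive (Derive p)) (Derive (Derive q)) k u v.
Proof.
  unfold xdd. rewrite <- pd_u_surf_rev. apply pd_ext. intros. apply pd_u_surf_rev.
Qed.

Lemma xdd_uv p q u v k : xdd (surf_rev p q) 0 1 u v k = rot_field (Derive p) k u v.
Proof.
  unfold xdd. rewrite <- pd_u_rot_field. apply pd_ext. intros. apply pd_v_surf_rev.
Qed.

Lemma xdd_vu p q u v k : xdd (surf_rev p q) 1 0 u v k = rot_field (Derive p) k u v.
Proof.
  unfold xdd. rewrite <- (pd_v_surf_rev _ (Derive q)).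
  apply pd_ext. intros. apply pd_u_surf_rev.
Qed.

Lemma xdd_vv p q u v k : xdd (surf_rev p q) 1 1 u v k = - surf_rev p (fun _ => 0) k u v.
Proof.
  unfold xdd. transitivity (pd 1 (rot_field p k) u v).
  - apply pd_ext. intros. apply pd_v_surf_rev.
  - apply is_derive_unique, is_derive_v_rot_field.
Qed.

(** The signed curvature of a plane curve parametrized by arc length; it is also the coefficient of
    [du^2] in the second fundamental form. *)
Definition profile_curv (p q : R -> R) (u : R) : R :=
  Derive p u * Derive (Derive q) u - Derive q u * Derive (Derive p) u.

Lemma sin_cos_pow2 v : sin v ^ 2 + cos v ^ 2 = 1.
Proof. rewrite <- !Rsqr_pow2. apply sin2_cos2. Qed.

(** The cross product is [p] times the rotated profile normal [(- q', p')], which has length 1 by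
    arc length. *)
Lemma unit_normal_surf_rev p q u v k :
  0 < p u -> Derive p u ^ 2 + Derive q u ^ 2 = 1 ->
  unit_normal (surf_rev p q) u v k
  = surf_rev (fun u => - Derive q u) (Derive p) k u v.
Proof.
  intros hp h1.
  assert (hcross : forall j, cross3 (xd (surf_rev p q) 0 u v) (xd (surf_rev p q) 1 u v) j
    = p u * surf_rev (fun u => - Derive q u) (Derive p) j u v).
  { intros j. unfold xd, cross3. rewrite !pd_u_surf_rev, !pd_v_surf_rev.
    destruct j as [| [| j]]; simpl; [ring | ring |].
    transitivity (p u * Derive p u * (sin v ^ 2 + cos v ^ 2)); [ring |].
    rewrite sin_cos_pow2. ring. }
  unfold unit_normal, norm3, dot3. rewrite !hcross.
  match goal with |- _ / sqrt ?e = _ => replace e with (Rsqr (p u)) end.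
  - rewrite sqrt_Rsqr by lra. field. lra.
  - simpl. unfold Rsqr. symmetry.
    transitivity (p u ^ 2 * (Derive q u ^ 2 * (sin v ^ 2 + cos v ^ 2) + Derive p u ^ 2)); [ring |].
    rewrite sin_cos_pow2, Rmult_1_r, (Rplus_comm (Derive q u ^ 2)), h1. ring.
Qed.

Lemma sff_surf_rev p q u v i j :
  0 < p u -> Derive p u ^ 2 + Derive q u ^ 2 = 1 ->
  sff (surf_rev p q) u v i j =
  match i, j with
  | O, O => profile_curv p q u
  | S _, S _ => p u * Derive q u
  | _, _ => 0
  end.
Proof.
  intros hp h1. unfold sff, dot3. rewrite !unit_normal_surf_rev by assumption.
  assert (e := sin_cos_pow2 v).
  destruct i as [| i], j as [| j].
  - rewrite !xdd_uu. unfold profile_curv. simpl.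
    transitivity (- Derive (Derive p) u * Derive q u * (sin v ^ 2 + cos v ^ 2)
      + Derive p u * Derive (Derive q) u); [ring | rewrite e; ring].
  - change (xdd (surf_rev p q) 0 (S j)) with (xdd (surf_rev p q) 0 1).
    rewrite !xdd_uv. simpl. ring.
  - change (xdd (surf_rev p q) (S i) 0) with (xdd (surf_rev p q) 1 0).
    rewrite !xdd_vu. simpl. ring.
  - change (xdd (surf_rev p q) (S i) (S j)) with (xdd (surf_rev p q) 1 1).
    rewrite !xdd_vv. simpl.
    transitivity (p u * Derive q u * (sin v ^ 2 + cos v ^ 2)); [ring | rewrite e; ring].
Qed.

Lemma bdet_surf_rev p q u v :
  0 < p u -> Derive p u ^ 2 + Derive q u ^ 2 = 1 ->
  bdet (surf_rev p q) u v = profile_curv p q u * (p u * Derive q u).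
Proof.
  intros hp h1. unfold bdet, det2. rewrite !sff_surf_rev by assumption. ring.
Qed.

(** * The Laplace operator of the second fundamental form *)

(** Keeping [sqrt (Rabs (f u))] as a factor lets it cancel against the prefactor of [LapII],
    whatever the sign of the determinant. *)
Lemma is_derive_sqrt_Rabs (f : R -> R) (u l : R) :
  is_derive f u l -> f u <> 0 ->
  is_derive (fun t => sqrt (Rabs (f t))) u (sqrt (Rabs (f u)) * (l / (2 * f u))).
Proof.
  intros hf hn.
  assert (hpos : 0 < Rabs (f u)) by now apply Rabs_pos_lt.
  assert (hs : 0 < sqrt (Rabs (f u))) by now apply sqrt_lt_R0.
  replace (sqrt (Rabs (f u)) * (l / (2 * f u)))
    with (sign (f u) * l / (2 * sqrt (Rabs (f u)))).
  - apply (is_derive_sqrt (fun t => Rabs (f t))); [now apply is_derive_Rabs | exact hpos].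
  - assert (e : sqrt (Rabs (f u)) * sqrt (Rabs (f u)) = sign (f u) * f u).
    { rewrite sqrt_sqrt by lra.
      destruct (Rdichotomy _ _ hn) as [h | h].
      - rewrite sign_eq_m1, Rabs_left by exact h. ring.
      - rewrite sign_eq_1, Rabs_pos_eq by lra. ring. }
    apply (Rmult_eq_reg_r (2 * f u * sqrt (Rabs (f u)))).
    + transitivity (sign (f u) * f u * l); [field; lra |].
      rewrite <- e. field. exact hn.
    + repeat apply Rmult_integral_contrapositive_currified; lra.
Qed.

(** The second fundamental form is diagonal with entries [k] and [p q']. The bracket collects twice
    the logarithmic derivative of [sqrt |k p q'|] and the term [- 2 k' / k] from differentiating
    [1 / k]. *)
Lemma LapII_surf_rev a b p q f u v k1 l m :
  a < u < b ->
  (forall t, a < t < b -> 0 < p t) ->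
  (forall t, a < t < b -> Derive p t ^ 2 + Derive q t ^ 2 = 1) ->
  (forall t, a < t < b -> profile_curv p q t <> 0) ->
  (forall t, a < t < b -> Derive q t <> 0) ->
  ex_derive p u -> ex_derive (Derive q) u ->
  is_derive (profile_curv p q) u k1 ->
  is_derive (fun t => pd 0 f t v) u l ->
  is_derive (fun t => pd 1 f u t) v m ->
  LapII (surf_rev p q) f u v
  = - (l / profile_curv p q u
       + pd 0 f u v / (2 * profile_curv p q u)
         * (- k1 / profile_curv p q u + Derive p u / p u + Derive (Derive q) u / Derive q u)
       + m / (p u * Derive q u)).
Proof.
  intros hu hp h1 hk hs exp exs hk1 hl hm.
  set (K := profile_curv p q) in *.
  assert (pu0 : p u <> 0) by (apply Rgt_not_eq, hp; assumption).
  assert (su0 := hs u hu). assert (ku0 := hk u hu).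
  assert (hb : forall t w, a < t < b -> bdet (surf_rev p q) t w = K t * (p t * Derive q t))
    by (intros; apply bdet_surf_rev; auto).
  assert (hinv : forall t w i j, a < t < b -> (i < 2)%nat -> (j < 2)%nat ->
    binv (surf_rev p q) t w i j =
    match i, j with O, O => / K t | S _, S _ => / (p t * Derive q t) | _, _ => 0 end).
  { intros t w i j ht hi hj. unfold binv, inv2.
    change (det2 (sff (surf_rev p q) t w)) with (bdet (surf_rev p q) t w). rewrite hb by exact ht.
    assert (p t <> 0) by (apply Rgt_not_eq, hp; assumption).
    destruct i as [| i], j as [| j]; rewrite sff_surf_rev by auto; fold K; field; auto. }
  set (B := fun t => K t * (p t * Derive q t)).
  set (W := fun t => sqrt (Rabs (B t))).
  assert (hB0 : B u <> 0)
    by (unfold B; repeat apply Rmult_integral_contrapositive_currified; assumption).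
  assert (hW0 : W u <> 0)
    by (apply Rgt_not_eq, sqrt_lt_R0, Rabs_pos_lt, hB0).
  assert (hBd : is_derive B u (k1 * (p u * Derive q u)
      + K u * (Derive p u * Derive q u + p u * Derive (Derive q) u))).
  { unfold B. auto_derive.
    - repeat split; try assumption. now exists k1.
    - subst_derive K hk1. subst_derive p (Derive_correct _ _ exp).
      subst_derive (Derive q) (Derive_correct _ _ exs). ring. }
  assert (hWd := is_derive_sqrt_Rabs B u _ hBd hB0). fold (W u) in hWd.
  change (fun t => sqrt (Rabs (B t))) with W in hWd.
  set (W1 := W u * _) in hWd.
  unfold LapII, sum2.
  rewrite hb by exact hu. fold (B u). fold (W u).
  assert (eu : is_derive (fun t => W t * (/ K t * pd 0 f t v)) u
     (W1 * (/ K u * pd 0 f u v) + W u * (- k1 / K u ^ 2 * pd 0 f u v + / K u * l))).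
  { set (g := fun t : R => pd 0 f t v).
    change (is_derive g u l) in hl. change (pd 0 f u v) with (g u).
    change (is_derive (fun t => W t * (/ K t * g t)) u
      (W1 * (/ K u * g u) + W u * (- k1 / K u ^ 2 * g u + / K u * l))).
    clearbody W1 W g.
    auto_derive.
    - repeat split; [now exists W1 | now exists k1 | exact ku0 | now exists l].
    - subst_derive K hk1. subst_derive g hl. subst_derive W hWd. field. exact ku0. }
  assert (ev : is_derive (fun t => W u * (/ (p u * Derive q u) * pd 1 f u t)) v
     (W u * (/ (p u * Derive q u) * m))).
  { apply is_derive_scal, is_derive_scal, hm. }
  match goal with |- _ * (?x + ?y) = _ => replace x with
    (W1 * (/ K u * pd 0 f u v) + W u * (- k1 / K u ^ 2 * pd 0 f u v + / K u * l));
    [replace y with (W u * (/ (p u * Derive q u) * m)) |] end.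
  - unfold W1, B. field. repeat split; assumption.
  - rewrite <- (is_derive_unique _ _ _ ev). unfold pd at 2. apply Derive_ext. intros t.
    rewrite hb, !hinv by (exact hu || auto). fold (B u). fold (W u). ring.
  (* The coefficient formulas hold for parameters in [(a, b)], so the [u]-derivatives are compared
     on a neighbourhood of [u]. *)
  - rewrite <- (is_derive_unique _ _ _ eu). unfold pd at 2. apply Derive_ext_loc.
    apply (locally_of_interval a b); [exact hu |]. intros t ht.
    rewrite hb, !hinv by (exact ht || auto). fold (B t). fold (W t). ring.
Qed.

Lemma is_derive_u_surf_rev f g k u v :
  ex_derive f u -> ex_derive g u ->
  is_derive (fun t => surf_rev f g k t v) u (surf_rev (Derive f) (Derive g) k u v).
Proof.
  intros hf hg. unfold surf_rev. destruct k as [| [| k]].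
  - auto_derive; [exact hf | subst_derive f (Derive_correct _ _ hf); ring].
  - auto_derive; [exact hf | subst_derive f (Derive_correct _ _ hf); ring].
  - now apply Derive_correct.
Qed.

Lemma LapII_surf_rev_coord a b p q k u v k1 :
  a < u < b ->
  (forall t, a < t < b -> 0 < p t) ->
  (forall t, a < t < b -> Derive p t ^ 2 + Derive q t ^ 2 = 1) ->
  (forall t, a < t < b -> profile_curv p q t <> 0) ->
  (forall t, a < t < b -> Derive q t <> 0) ->
  ex_derive p u -> ex_derive (Derive p) u -> ex_derive (Derive q) u ->
  is_derive (profile_curv p q) u k1 ->
  LapII (surf_rev p q) (surf_rev p q k) u v
  = - (surf_rev (Derive (Derive p)) (Derive (Derive q)) k u v / profile_curv p q u
       + surf_rev (Derive p) (Derive q) k u v / (2 * profile_curv p q u)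
         * (- k1 / profile_curv p q u + Derive p u / p u + Derive (Derive q) u / Derive q u)
       + - surf_rev p (fun _ => 0) k u v / (p u * Derive q u)).
Proof.
  intros hu hp h1 hk hs exp exc exs hk1.
  rewrite <- (pd_u_surf_rev p q).
  apply (LapII_surf_rev a b); try assumption.
  - apply is_derive_ext with (fun t => surf_rev (Derive p) (Derive q) k t v).
    + intros t. symmetry. apply pd_u_surf_rev.
    + now apply is_derive_u_surf_rev.
  - apply is_derive_ext with (fun t => rot_field p k u t).
    + intros t. symmetry. apply pd_v_surf_rev.
    + apply is_derive_v_rot_field.
Qed.

(** * Reduction from the surface to its profile, and the conclusion *)

(** Differentiating the arc-length condition gives [p' p'' + q' q'' = 0], hence the Frenet
    equations. Nonzero Gaussian curvature makes the determinant [k p q'] nonzero. *)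
Lemma surf_rev_arc_profile a b p q :
  smooth_on p a b -> smooth_on q a b ->
  (forall u, a < u < b -> 0 < p u) ->
  (forall u, a < u < b -> Derive p u ^ 2 + Derive q u ^ 2 = 1) ->
  (forall u v, in_dom a b u v -> gauss_curv (surf_rev p q) u v <> 0) ->
  arc_profile a b p q (Derive p) (Derive q) (profile_curv p q).
Proof.
  intros sp sq hp h1 hK.
  assert (dp := fun u hu => Derive_correct _ _ (sp 0%nat u hu)).
  assert (dq := fun u hu => Derive_correct _ _ (sq 0%nat u hu)).
  assert (dc : forall u, a < u < b -> is_derive (Derive p) u (Derive (Derive p) u))
    by (intros u hu; exact (Derive_correct _ _ (sp 1%nat u hu))).
  assert (ds : forall u, a < u < b -> is_derive (Derive q) u (Derive (Derive q) u))
    by (intros u hu; exact (Derive_correct _ _ (sq 1%nat u hu))).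
  assert (orth : forall u, a < u < b ->
    Derive p u * Derive (Derive p) u + Derive q u * Derive (Derive q) u = 0).
  { intros u hu. generalize (dc u hu) (ds u hu) h1.
    generalize (Derive (Derive p) u) (Derive (Derive q) u).
    generalize (Derive p) (Derive q). intros c s c1 s1 hc hs hcs.
    assert (hd : is_derive (fun t => c t ^ 2 + s t ^ 2 - 1) u (2 * (c u * c1 + s u * s1))).
    { auto_derive; [split; [now exists c1 | split; [now exists s1 | trivial]] |].
      subst_derive c hc. subst_derive s hs. ring. }
    apply is_derive_locally_zero in hd; [lra |].
    apply (locally_of_interval a b); [exact hu |]. intros t ht. rewrite hcs; [ring | exact ht]. }
  assert (hn : forall u, a < u < b -> profile_curv p q u * (p u * Derive q u) <> 0).
  { intros u hu. rewrite <- (bdet_surf_rev p q u 0) by auto. intros h.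
    apply (hK u 0).
    - split; [exact hu |]. generalize PI_RGT_0. lra.
    - unfold gauss_curv. change (det2 (sff (surf_rev p q) u 0)) with (bdet (surf_rev p q) u 0).
      rewrite h. unfold Rdiv. ring. }
  constructor.
  - exact dp.
  - exact dq.
  - intros u hu. generalize (dc u hu).
    replace (- profile_curv p q u * Derive q u) with (Derive (Derive p) u); [easy |].
    unfold profile_curv. generalize (h1 u hu) (orth u hu). intros e1 e2.
    scale e1 (Derive (Derive p) u). scale e2 (Derive p u). lra.
  - intros u hu. generalize (ds u hu).
    replace (profile_curv p q u * Derive p u) with (Derive (Derive q) u); [easy |].
    unfold profile_curv. generalize (h1 u hu) (orth u hu). intros e1 e2.
    scale e1 (Derive (Derive q) u). scale e2 (Derive q u). lra.
  - exact hp.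
  - exact h1.
  - intros u hu h. apply (hn u hu). rewrite h. ring.
  - intros u hu h. apply (hn u hu). rewrite h. ring.
Qed.

(* The matrix equation at [v = 0] and [v = PI] isolates the diagonal entries
   [A 0 0] and [A 2 2]. *)
Lemma surf_rev_spectral_profile a b p q A :
  smooth_on p a b -> smooth_on q a b ->
  (forall u, a < u < b -> 0 < p u) ->
  (forall u, a < u < b -> Derive p u ^ 2 + Derive q u ^ 2 = 1) ->
  arc_profile a b p q (Derive p) (Derive q) (profile_curv p q) ->
  (forall u v (k : nat), in_dom a b u v -> (k < 3)%nat ->
     LapII (surf_rev p q) (surf_rev p q k) u v
     = matvec3 A (fun j => surf_rev p q j u v) k) ->
  spectral_profile a b (A 0%nat 0%nat) (A 2%nat 2%nat) p q (Derive p) (Derive q)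
    (profile_curv p q).
Proof.
  intros sp sq hp h1 H hA.
  assert (hs := prof_s_neq0 _ _ _ _ _ _ _ H). assert (hk := prof_k_neq0 _ _ _ _ _ _ _ H).
  (* The radial and axial components; [- L] is the coefficient of the first [u]-derivative in
     [LapII]. *)
  assert (key : forall u, a < u < b -> exists k1 : R, is_derive (profile_curv p q) u k1 /\
    let L := (- k1 / profile_curv p q u + Derive p u / p u
              + profile_curv p q u * Derive p u / Derive q u) / (2 * profile_curv p q u) in
    Derive q u - Derive p u * L + / Derive q u = A 0%nat 0%nat * p u /\
    - (Derive p u + Derive q u * L) = A 2%nat 2%nat * q u).
  { intros u hu.
    assert (dp : ex_derive p u) by exact (sp 0%nat u hu).
    assert (dc : ex_derive (Derive p) u) by exact (sp 1%nat u hu).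
    assert (ds : ex_derive (Derive q) u) by exact (sq 1%nat u hu).
    assert (dc1 : ex_derive (Derive (Derive p)) u) by exact (sp 2%nat u hu).
    assert (ds1 : ex_derive (Derive (Derive q)) u) by exact (sq 2%nat u hu).
    assert (dk : ex_derive (profile_curv p q) u).
    { unfold profile_curv. apply (ex_derive_minus (V := R_NormedModule));
        apply ex_derive_mult; assumption. }
    exists (Derive (profile_curv p q) u). split; [now apply Derive_correct |].
    assert (hlap := fun k v => LapII_surf_rev_coord a b p q k u v _ hu hp h1 hk hs dp dc ds
      (Derive_correct _ _ dk)).
    assert (d0 : in_dom a b u 0) by (split; [exact hu | generalize PI_RGT_0; lra]).
    assert (dPI : in_dom a b u PI) by (split; [exact hu | generalize PI_RGT_0; lra]).
    assert (p0 : p u <> 0) by (apply Rgt_not_eq, hp, hu).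
    assert (s0 := hs u hu). assert (k0 := hk u hu).
    (* At both angles [sin] vanishes. Passing from [0] to [PI] changes the sign of the radial
       coordinate: the difference of the two row 0 equations removes [A 0 2], the sum of the two row
       2 equations removes [A 2 0]. *)
    generalize (hA u 0 0%nat d0 ltac:(auto)) (hA u PI 0%nat dPI ltac:(auto))
      (hA u 0 2%nat d0 ltac:(auto)) (hA u PI 2%nat dPI ltac:(auto)).
    rewrite !hlap. unfold matvec3. simpl surf_rev.
    rewrite cos_0, cos_PI, sin_0, sin_PI.
    rewrite (is_derive_unique _ _ _ (prof_c _ _ _ _ _ _ _ H u hu)).
    rewrite (is_derive_unique _ _ _ (prof_s _ _ _ _ _ _ _ H u hu)).
    generalize (Derive (profile_curv p q) u).
    revert s0 k0 p0.
    generalize (profile_curv p q u) (Derive q u) (Derive p u) (p u) (q u).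
    intros k s c P Q s0 k0 p0 k1 e1 e2 e3 e4. cbv zeta.
    set (L := (- k1 / k + c / P + k * c / s)) in *.
    split.
    - transitivity (- (- k * s * 1 / k + c * 1 / (2 * k) * L + - (P * 1) / (P * s)));
        [field; auto |].
      assert (e : - (- k * s * -1 / k + c * -1 / (2 * k) * L + - (P * -1) / (P * s))
        = - - (- k * s * 1 / k + c * 1 / (2 * k) * L + - (P * 1) / (P * s)))
        by (field; auto).
      lra.
    - transitivity (- (k * c / k + s / (2 * k) * L + - 0 / (P * s))); [field; auto | lra]. }
  constructor.
  (* [q'] times the radial equation minus [p'] times the axial one: [L] cancels. *)
  - intros u hu. destruct (key u hu) as [k1 [_ [e1 e2]]]. revert e1 e2.
    set (L := _ / (2 * _)). intros e1 e2.
    assert (es : / Derive q u * Derive q u = 1) by (apply Rinv_l, hs, hu).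
    generalize (h1 u hu). scale e1 (Derive q u). scale e2 (Derive p u). lra.
  (* [p'] times the radial equation plus [q'] times the axial one gives [p' / q' - L = T], which is
     solved for [k']. *)
  - intros u hu. destruct (key u hu) as [k1 [hk1 [e1 e2]]].
    match goal with |- is_derive _ _ ?r => replace r with k1; [exact hk1 |] end.
    assert (p0 : p u <> 0) by (apply Rgt_not_eq, hp, hu).
    replace (A 0%nat 0%nat * p u * Derive p u + A 2%nat 2%nat * q u * Derive q u)
      with (Derive p u * / Derive q u - (Derive p u ^ 2 + Derive q u ^ 2)
        * ((- k1 / profile_curv p q u + Derive p u / p u
              + profile_curv p q u * Derive p u / Derive q u) / (2 * profile_curv p q u)))
      by (rewrite <- e1, <- e2; ring).
    rewrite h1 by exact hu. field.
    repeat split; [apply hs, hu | exact p0 | apply hk, hu].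
Qed.

Theorem mainTheorem1 :
  forall (a b : R) (p q : R -> R) (A : nat -> nat -> R),
    a < b ->
    smooth_on p a b -> smooth_on q a b ->
    (forall u, a < u < b -> 0 < p u) ->
    (forall u, a < u < b -> (Derive p u) ^ 2 + (Derive q u) ^ 2 = 1) ->
    (forall u v, in_dom a b u v -> gauss_curv (surf_rev p q) u v <> 0) ->
    (forall u v (k : nat), in_dom a b u v -> (k < 3)%nat ->
       LapII (surf_rev p q) (surf_rev p q k) u v
       = matvec3 A (fun j => surf_rev p q j u v) k) ->
    (exists c d, 0 < c /\
       forall u v, in_dom a b u v -> on_catenoid c d (fun k => surf_rev p q k u v))
    \/
    (exists (C : nat -> R) (r : R), 0 < r /\
       forall u v, in_dom a b u v -> on_sphere C r (fun k => surf_rev p q k u v)).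
Proof.
  intros a b p q A hab sp sq hp h1 hK hA.
  assert (H := surf_rev_arc_profile a b p q sp sq hp h1 hK).
  assert (S := surf_rev_spectral_profile a b p q A sp sq hp h1 H hA).
  assert (hrad : forall u v, (p u * cos v) ^ 2 + (p u * sin v) ^ 2 = p u ^ 2).
  { intros u v. transitivity (p u ^ 2 * (sin v ^ 2 + cos v ^ 2)); [ring |].
    rewrite sin_cos_pow2. ring. }
  destruct (Req_dec (A 0%nat 0%nat) (A 2%nat 2%nat)) as [he | he].
  - right. destruct (spectral_sphere _ _ _ _ _ _ _ _ _ H S hab he) as [r [hr hsph]].
    exists (fun _ => 0), r. split; [exact hr |].
    intros u v [hu _]. unfold on_sphere. simpl surf_rev.
    rewrite !Rminus_0_r, hrad. now apply hsph.
  - left. rewrite (spectral_mu_eq0 _ _ _ _ _ _ _ _ _ H S hab he) in S.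
    destruct (spectral_catenoid _ _ _ _ _ _ _ _ H S hab) as [r [d [hr hcat]]].
    exists r, d. split; [exact hr |].
    intros u v [hu _]. unfold on_catenoid. simpl surf_rev.
    rewrite hrad, sqrt_pow2 by (apply Rlt_le, hp, hu). now apply hcat.
Qed.
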